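(* Let $P_\nu(x)=I_\nu(x)K_\nu(x)$. For all $\nu>\frac{1}{2}$ and $x>0$, $$P_\nu^2(x)-P_{\nu-1}(x)P_{\nu+1}(x)<\frac{1}{\nu+\frac{1}{2}}P_\nu^2(x).$$
   Context: $I_\nu$ and $K_\nu$ denote the modified Bessel functions of the first and second kind of order $\nu$; $P_\nu^2(x)$ means $(P_\nu(x))^2$. *)

(* Defs.v *)
From HB Require Import structures.
From mathcomp Require Import all_boot all_order all_algebra.
From mathcomp Require Import all_classical all_reals all_analysis.

Set Implicit Arguments.
Unset Strict Implicit.
Unset Printing Implicit Defensive.

Import Order.TTheory GRing.Theory Num.Theory.
Import numFieldNormedType.Exports.

Local Open Scope classical_set_scope.
Local Open Scope ring_scope.

(* Euler's integral; meaningful for [0 < z] only. *)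
Definition euler_gamma (R : realType) (z : R) : R :=
  \int[@lebesgue_measure R]_(t in `]0, +oo[) (t `^ (z - 1) * expR (- t)).

(* 1 / Gamma on the whole real line. For [z <= 0] the functional equation
   Gamma (z + n) = z (z + 1) ... (z + n - 1) Gamma z is used with the least [n]
   such that [0 < z + n]; at the poles z = 0, -1, -2, ... of Gamma the product
   vanishes, in accordance with the convention 1 / Gamma = 0 there. *)
Definition rgamma (R : realType) (z : R) : R :=
  if 0 < z then (euler_gamma z)^-1
  else let n := (Num.truncn (- z)).+1 in
       (\prod_(i < n) (z + i%:R)) / euler_gamma (z + n%:R).

(* I_nu(x) = sum_{k >= 0} (x/2)^(2k + nu) / (k! Gamma(nu + k + 1)), [0 < x]. *)
Definition besselI (R : realType) (nu x : R) : R :=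
  limn (series (fun k : nat =>
    (x / 2) `^ (k.*2%:R + nu) * rgamma (nu + k%:R + 1) / k`!%:R)).

Definition besselK_quotient (R : realType) (nu x : R) : R :=
  pi / 2 * ((besselI (- nu) x - besselI nu x) / sin (nu * pi)).

(* At integral orders the quotient is 0 / 0 and is replaced by its limit as the
   order tends to [nu]. *)
Definition besselK (R : realType) (nu x : R) : R :=
  if nu \is a Num.int then lim (besselK_quotient mu x @[mu --> nu^'])
  else besselK_quotient nu x.

Definition besselP (R : realType) (nu x : R) : R :=
  besselI nu x * besselK nu x.

(* Main.v *)
(** Write [y = (x/2)^2], [E nu y = sum_k y^k / (k! Gamma(nu + k + 1))]
    ([bessel_series]) and [M a y = \int_0^oo t^(a-1) exp(-t - y/t) dt]
    ([bessel_mellin]), so that [I_nu(x) = (x/2)^nu E nu y].  From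
    [E' nu = E (nu + 1)], [M' a = - M (a - 1)] and the three-term recurrences of
    [E] and [M], the Wronskian-type expressions
    [E nu * M (nu + 1) + y * E (nu + 1) * M nu] and
    [E (- nu - 1) * E nu - y * E (- nu) * E (nu + 1)] do not depend on [y];
    their values are found by letting [y] tend to 0.  Together with the symmetry
    [M (- nu) = y^(- nu) M nu] (substitution [t -> y/t]) they give
    [E (- nu) - y^nu E nu = M nu / (Gamma nu * Gamma (1 - nu))], that is, up to a
    nonzero 1-periodic function of [nu], [K_nu(x) = (x/2)^(- nu) M nu / 2].  (By
    the reflection formula the periodic function is 1, but homogeneity makes this
    irrelevant; only its limit at the integers is needed.)

    Hence [P_nu] is [E nu * M nu] up to that factor.  Cauchy-Schwarz for the
    integral gives [M nu ^ 2 <= M (nu - 1) * M (nu + 1)], and Cauchy-Schwarz for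
    the series gives [E nu ^ 2 <= E (nu + 1) * (E (nu - 1) + E nu)], which with
    [nu * E nu <= E (nu - 1)] yields
    [nu / (nu + 1) * E nu ^ 2 <= E (nu - 1) * E (nu + 1)].  The theorem follows
    since [1 - 1 / (nu + 1/2) < nu / (nu + 1)]. *)

Require Import Defs.
From HB Require Import structures.
From mathcomp Require Import all_boot all_order all_algebra.
From mathcomp Require Import ring lra.
From mathcomp Require Import all_classical all_reals all_analysis.
From mathcomp Require Import measurable_realfun lebesgue_integral_under.
Set Implicit Arguments.
Unset Strict Implicit.
Unset Printing Implicit Defensive.
Import Order.TTheory GRing.Theory Num.Theory.
Import numFieldNormedType.Exports.
Local Open Scope classical_set_scope.
Local Open Scope ring_scope.

(** * Integrals over the open half-line as limits over compact segments *)

Section halfline_integral.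
Context {R : realType}.
Notation mu := (@lebesgue_measure R).
Implicit Types (f g F : R -> R) (a b c t B : R).

(** The scale [c] is left free because [t -> y / t] carries the segments for [c = 1] onto those for
    [c = y]. *)
Lemma halfline_bigcup c : 0 < c ->
  `]0, +oo[%classic = \bigcup_n `[c / n.+1%:R, c * n.+1%:R]%classic :> set R.
Proof.
move=> c0; apply/seteqP; split => [t|t [n _]] /=; rewrite !in_itv/= ?andbT.
  (* The successor of this index exceeds both ratios: [t / c] controls the right endpoint and
     [c / t] the left one. *)
  move=> t0; exists (Num.truncn (t / c + c / t)) => //=.
  have tc : 0 < t / c by rewrite divr_gt0.
  have ct : 0 < c / t by rewrite divr_gt0.
  have := truncnS_gt (t / c + c / t); set m := (_.+1)%:R => mlt.
  rewrite in_itv/=; apply/andP; split.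
    rewrite ler_pdivrMr ?ltr0n// -ler_pdivrMl// mulrC.
    by apply: ltW; apply: le_lt_trans mlt; lra.
  rewrite -ler_pdivrMl// mulrC.
  by apply: ltW; apply: le_lt_trans mlt; lra.
by move=> /andP[+ _]; apply: lt_le_trans; rewrite divr_gt0 ?ltr0n.
Qed.

Lemma halfline_segment c n t : 0 < c ->
  t \in `[c / n.+1%:R, c * n.+1%:R] -> 0 < t.
Proof.
move=> c0; rewrite in_itv/= => /andP[+ _].
by apply: lt_le_trans; rewrite divr_gt0 ?ltr0n.
Qed.

Lemma halfline_continuous_within f a b : 0 < a ->
  {in `]0, +oo[, continuous f} -> {within `[a, b], continuous f}.
Proof.
move=> a0 cf; apply: continuous_in_subspaceT => t /set_mem/=.
rewrite in_itv/= => /andP[ta _]; apply: cf.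
by rewrite in_itv/= andbT (lt_le_trans a0).
Qed.

Lemma halfline_continuous_measurable f :
  {in `]0, +oo[, continuous f} -> measurable_fun `](0 : R), +oo[ f.
Proof.
move=> cf; apply: open_continuous_measurable_fun => //.
by move=> t /set_mem; exact: cf.
Qed.

Lemma ge0_cvg_halfline_integral f c : 0 < c ->
  {in `]0, +oo[, continuous f} -> (forall t, 0 < t -> 0 <= f t) ->
  (\int[mu]_(t in `[(c / n.+1%:R)%R, (c * n.+1%:R)%R]) (f t)%:E)%E @[n --> \oo] -->
  (\int[mu]_(t in `]0%R, +oo[) (f t)%:E)%E.
Proof.
move=> c0 cf f0; rewrite (halfline_bigcup c0).
apply: (@ge0_nondecreasing_set_cvg_integral _ (measurableTypeR R) R
  (fun n => `[c / n.+1%:R, c * n.+1%:R]%classic) (EFin \o f) mu) => //=.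
- apply/nondecreasing_seqP => n; rewrite subsetEset => t /=.
  rewrite !in_itv/= => /andP[h1 h2]; apply/andP; split.
    apply: le_trans h1; rewrite ler_pM2l// lef_pV2 ?posrE ?ltr0n//.
    by rewrite ler_nat.
  by apply: (le_trans h2); rewrite ler_pM2l// ler_nat.
- move=> n; apply/measurable_EFinP.
  apply: measurable_funS (halfline_continuous_measurable cf) => //.
  by move=> t /= /(halfline_segment c0) t0; rewrite in_itv/= t0.
- by move=> n t /(halfline_segment c0) t0; rewrite lee_fin f0.
Qed.

Lemma halfline_FTC2 f F a b : 0 < a -> a < b ->
  {in `]0, +oo[, continuous f} ->
  (forall t, 0 < t -> is_derive t (1 : R) F (f t)) ->
  (\int[mu]_(t in `[a, b]) (f t)%:E)%E = (F b - F a)%:E.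
Proof.
move=> a0 ab cf dF.
have cF t : 0 < t -> {for t, continuous F}.
  by move=> /dF dFt; apply/differentiable_continuous/derivable1_diffP.
rewrite EFinB; apply: continuous_FTC2 => //.
- exact: halfline_continuous_within.
- split.
  + move=> t; rewrite in_itv/= => /andP[ta _].
    by have := dF t (lt_trans a0 ta).
  + exact/cvg_at_right_filter/cF.
  + exact/cvg_at_left_filter/cF/(lt_trans a0).
- move=> t; rewrite in_itv/= => /andP[ta _].
  by have h := dF t (lt_trans a0 ta); rewrite derive1E derive_val.
Qed.

(** Each segment integral is [F b - F a], hence at most [B + B], and monotone convergence passes the
    bound to the half-line. *)
Lemma halfline_bounded_primitive_integrable f F B :
  {in `]0, +oo[, continuous f} -> (forall t, 0 < t -> 0 <= f t) ->
  (forall t, 0 < t -> is_derive t (1 : R) F (f t)) ->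
  (forall t, 0 < t -> `|F t| <= B) ->
  mu.-integrable `](0 : R), +oo[ (EFin \o f).
Proof.
move=> cf f0 dF FB; apply/integrableP; split.
  by apply/measurable_EFinP; exact: halfline_continuous_measurable.
rewrite (@eq_integral _ _ _ mu _ (fun t => (f t)%:E)); last first.
  move=> t /set_mem/=; rewrite in_itv/= andbT => t0.
  by rewrite ger0_norm// f0.
have h := ge0_cvg_halfline_integral ltr01 cf f0.
apply: (@le_lt_trans _ _ (B + B)%:E); last exact: ltry.
rewrite -(cvg_lim _ h)//; apply: lime_le; first exact: (cvgP _ h).
(* For [n = 0] the segment degenerates to a point, while [halfline_FTC2] asks for [a < b]. *)
exists 1%N => // n /= n0.
have n1 : 1 < n.+1%:R :> R by rewrite ltr1n.
have n01 : 0 < 1 / n.+1%:R :> R by rewrite divr_gt0.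
rewrite (@halfline_FTC2 f F)//; last first.
  by rewrite ltr_pdivrMr ?ltr0n// mul1r; nra.
rewrite lee_fin (le_trans (ler_norm _))// (le_trans (ler_normB _ _))//.
by rewrite lerD ?FB// mul1r ltr0n.
Qed.

(** The signed derivative of [F] enters as a difference of two nonnegative integrands, to each of
    which the limit over segments applies; the boundary values of [F] vanish at both ends. *)
Lemma halfline_integral_primitive_eq0 f g F :
  {in `]0, +oo[, continuous f} -> {in `]0, +oo[, continuous g} ->
  (forall t, 0 < t -> 0 <= f t) -> (forall t, 0 < t -> 0 <= g t) ->
  mu.-integrable `](0 : R), +oo[ (EFin \o f) ->
  mu.-integrable `](0 : R), +oo[ (EFin \o g) ->
  (forall t, 0 < t -> is_derive t (1 : R) F (f t - g t)) ->
  F n.+1%:R @[n --> \oo] --> 0 -> F n.+1%:R^-1 @[n --> \oo] --> 0 ->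
  \int[mu]_(t in `]0, +oo[) f t = \int[mu]_(t in `]0, +oo[) g t.
Proof.
move=> cf cg f0 g0 intf intg dF Foo F0.
have hf := ge0_cvg_halfline_integral ltr01 cf f0.
have hg := ge0_cvg_halfline_integral ltr01 cg g0.
have ff : (\int[mu]_(t in `]0%R, +oo[) (f t)%:E)%E \is a fin_num.
  exact: integrable_fin_num.
have fg : (\int[mu]_(t in `]0%R, +oo[) (g t)%:E)%E \is a fin_num.
  exact: integrable_fin_num.
have h := cvgeB (fin_num_adde_defr _ ff) hf hg.
have h0 : (F n.+1%:R - F n.+1%:R^-1)%:E @[n --> \oo] --> (0 - 0)%:E.
  by apply: cvg_EFin; [exact: nearW | exact: cvgB].
apply/eqP; rewrite -subr_eq0 /Rintegral -fineB//; apply/eqP.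
suff -> : ((\int[mu]_(t in `]0%R, +oo[) (f t)%:E) -
  (\int[mu]_(t in `]0%R, +oo[) (g t)%:E) = (0 - 0)%:E)%E by rewrite subr0.
suff h' : (F n.+1%:R - F n.+1%:R^-1)%:E @[n --> \oo] -->
    (\int[mu]_(t in `]0%R, +oo[) (f t)%:E -
     \int[mu]_(t in `]0%R, +oo[) (g t)%:E)%E.
  exact: (cvg_unique _ h' h0).
suff e : {near \oo,
    (fun n => \int[mu]_(t in `[(1 / n.+1%:R)%R, (1 * n.+1%:R)%R]) (f t)%:E -
      \int[mu]_(t in `[(1 / n.+1%:R)%R, (1 * n.+1%:R)%R]) (g t)%:E)%E =1
    (fun n => (F n.+1%:R - F n.+1%:R^-1)%:E)}.
  by move/near_eq_cvg/cvg_trans : e; apply; exact: h.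
exists 1%N => // n /= n0.
have n1 : 1 < n.+1%:R :> R by rewrite ltr1n.
have n01 : 0 < n.+1%:R^-1 :> R by rewrite invr_gt0.
have lt1 : n.+1%:R^-1 < n.+1%:R :> R.
  by apply: (@lt_trans _ _ 1) => //; rewrite invf_lt1// ltr0n.
rewrite !mul1r -(@halfline_FTC2 (f \- g) F)//; last first.
  by move=> t t0; apply: continuousB; [exact: cf|exact: cg].
have sub : `[n.+1%:R^-1, n.+1%:R]%classic `<=` `](0 : R), +oo[%classic.
  by move=> t /=; rewrite !in_itv/= andbT => /andP[+ _]; exact: lt_le_trans.
by rewrite -integralB_EFin//; [exact: integrableS intf|exact: integrableS intg].
Qed.

End halfline_integral.

(** * The inversion [t -> y / t] and the kernel of the Mellin integral *)

Section bessel_kernel.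
Context {R : realType}.
Notation mu := (@lebesgue_measure R).
Implicit Types (a b c t y s u v : R).

Lemma gt0_itvoy t : 0 < t -> t \in `]0, +oo[.
Proof. by rewrite in_itv/= andbT. Qed.

Lemma is_derive_continuous (f : R -> R) t d :
  is_derive t (1 : R) f d -> {for t, continuous f}.
Proof. by move=> df; apply/differentiable_continuous/derivable1_diffP. Qed.

Lemma is_derive_div y t : 0 < t ->
  is_derive t (1 : R) (fun t => y / t) (- (y / t ^+ 2)).
Proof.
move=> t0; have tn0 : t != 0 by rewrite gt_eqF.
apply: is_derive_eq; first by apply: is_deriveM; apply: is_deriveV.
by rewrite /GRing.scale/= mulr0 addr0 mulr1 expr2 invfM; ring.
Qed.

Lemma is_derive_div_sqr y t : 0 < t ->
  is_derive t (1 : R) (fun t => y / t ^+ 2) (- (2 * y / t ^+ 3)).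
Proof.
move=> t0; have tn0 : t != 0 by rewrite gt_eqF.
apply: is_derive_eq.
  by apply: is_deriveM; apply: is_deriveV; rewrite expf_neq0.
rewrite /GRing.scale/= /GRing.scale/=.
by field.
Qed.

Lemma derive1_div_near y t : 0 < t ->
  \forall s \near t, derive1 (fun t => y / t) s = - (y / s ^+ 2).
Proof.
move=> t0; near=> s.
have s0 : 0 < s by near: s; exact: lt_nbhsr.
by have h := is_derive_div y s0; rewrite derive1E derive_val.
Unshelve. all: by end_near. Qed.

Lemma continuous_derive1_div y t : 0 < t ->
  {for t, continuous (derive1 (fun t => y / t))}.
Proof.
move=> t0.
have e := derive1_div_near y t0.
have ct : {for t, continuous (fun t => - (y / t ^+ 2))}.
  by apply: continuousN; apply: is_derive_continuous (is_derive_div_sqr y t0).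
rewrite /prop_for /continuous_at (nbhs_singleton e).
apply: cvg_trans ct; apply: near_eq_cvg.
by near do apply/esym.
Unshelve. all: by end_near. Qed.

(** Decreasing substitution [t -> y / t] on compact segments, followed by exhaustion at scale [y] on
    one side and 1 on the other. *)
Lemma halfline_integral_inversion (G : R -> R) y : 0 < y ->
  {in `]0, +oo[, continuous G} -> (forall t, 0 < t -> 0 <= G t) ->
  \int[mu]_(t in `]0, +oo[) G t =
  \int[mu]_(t in `]0, +oo[) (G (y / t) * (y / t ^+ 2)).
Proof.
move=> y0 cG G0; congr fine.
have cH : {in `]0, +oo[, continuous (fun t => G (y / t) * (y / t ^+ 2))}.
  move=> t; rewrite in_itv/= andbT => t0.
  apply: (@continuousM R R (fun t => G (y / t)) (fun t => y / t ^+ 2)).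
    apply: (@continuous_comp _ _ _ (fun t => y / t)).
      exact: is_derive_continuous (is_derive_div y t0).
    by apply: cG; rewrite gt0_itvoy// divr_gt0.
  exact: is_derive_continuous (is_derive_div_sqr y t0).
have H0 t : 0 < t -> 0 <= G (y / t) * (y / t ^+ 2).
  move=> t0; apply: mulr_ge0; first by rewrite G0// divr_gt0.
  by rewrite divr_ge0 ?sqr_ge0// ltW.
have h1 := ge0_cvg_halfline_integral y0 cG G0.
have h2 := ge0_cvg_halfline_integral ltr01 cH H0.
suff e : (fun n => \int[mu]_(t in `[(y / n.+1%:R)%R, (y * n.+1%:R)%R]) (G t)%:E)%E =
    (fun n => \int[mu]_(t in `[(1 / n.+1%:R)%R, (1 * n.+1%:R)%R])
      (G (y / t) * (y / t ^+ 2))%:E)%E.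
  by rewrite e in h1; exact: (cvg_unique _ h1 h2).
apply/funext => n.
have n0 : 0 < n.+1%:R :> R by rewrite ltr0n.
have n1 : 1 <= n.+1%:R :> R by rewrite ler1n.
have ab : 1 / n.+1%:R <= 1 * n.+1%:R :> R.
  by rewrite ler_pdivrMr// mul1r; nra.
have a0 : 0 < 1 / n.+1%:R :> R by rewrite divr_gt0.
have := @integration_by_substitution_decreasing R (fun t => y / t) G _ _ ab.
rewrite !mul1r invrK => -> //.
- apply: eq_integral => t /set_mem/=; rewrite in_itv/= => /andP[ta _].
  have t0 : 0 < t by apply: lt_le_trans ta; rewrite invr_gt0.
  rewrite !fctE; congr (_ * _)%:E.
  by rewrite (nbhs_singleton (derive1_div_near y t0)) opprK.
- move=> s t; rewrite !in_itv/= => /andP[sa _] /andP[ta _] st.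
  have s0 : 0 < s by apply: lt_le_trans sa; rewrite invr_gt0.
  have t0 : 0 < t by apply: lt_le_trans ta; rewrite invr_gt0.
  by rewrite ltr_pM2l// ltf_pV2 ?posrE.
- move=> t; rewrite in_itv/= => /andP[ta _]; apply: continuous_derive1_div.
  by apply: lt_trans ta; rewrite invr_gt0.
- apply/cvg_ex; eexists; apply: cvg_at_right_filter; apply: continuous_derive1_div.
  by rewrite invr_gt0.
- apply/cvg_ex; eexists; apply: cvg_at_left_filter.
  exact: continuous_derive1_div.
- split.
  + move=> t; rewrite in_itv/= => /andP[ta _].
    have t0 : 0 < t by apply: lt_trans ta; rewrite invr_gt0.
    by have := is_derive_div y t0.
  + apply: cvg_at_right_filter; apply: is_derive_continuous (is_derive_div y _).
    by rewrite invr_gt0.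
  + by apply: cvg_at_left_filter; apply: is_derive_continuous (is_derive_div y _).
- by apply: halfline_continuous_within cG; rewrite divr_gt0.
Qed.

(** At [y = 0] this is Euler's integrand, so facts about the kernel also serve the Gamma
    function. *)
Definition bessel_kernel a y t := t `^ (a - 1) * expR (- t - y / t).

Definition bessel_mellin a y := \int[mu]_(t in `]0, +oo[) bessel_kernel a y t.

Lemma euler_gammaE a : euler_gamma a = bessel_mellin a 0.
Proof.
by apply: eq_Rintegral => t _; rewrite /bessel_kernel mul0r subr0.
Qed.

Lemma bessel_kernel_ge0 a y t : 0 <= bessel_kernel a y t.
Proof. by rewrite mulr_ge0 ?powR_ge0 ?expR_ge0. Qed.

Lemma bessel_kernel_gt0 a y t : 0 < t -> 0 < bessel_kernel a y t.
Proof. by move=> t0; rewrite mulr_gt0 ?powR_gt0 ?expR_gt0. Qed.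

Lemma powR_mulB1 a t : 0 < t -> t `^ a = t * t `^ (a - 1).
Proof.
move=> t0; rewrite -{2}(powRr1 (ltW t0)) -powRD ?(gt_eqF t0) ?implybT//.
by rewrite subrKC.
Qed.

Lemma bessel_kernelM a y t : 0 < t ->
  bessel_kernel (a + 1) y t = t * bessel_kernel a y t.
Proof. by move=> t0; rewrite /bessel_kernel addrK mulrA -powR_mulB1. Qed.

Lemma bessel_kernelV a y t : 0 < t ->
  bessel_kernel (a - 1) y t = bessel_kernel a y t / t.
Proof.
move=> t0; rewrite -[in RHS](subrK 1 a) bessel_kernelM// mulrAC divff ?mul1r//.
by rewrite gt_eqF.
Qed.

(** Integrated over the half-line, where the boundary terms vanish, this derivative yields the
    three-term recurrence of [bessel_mellin]. *)
Lemma is_derive_bessel_kernel a y t : 0 < t ->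
  is_derive t (1 : R) (bessel_kernel (a + 1) y)
    (a * bessel_kernel a y t - bessel_kernel (a + 1) y t
     + y * bessel_kernel (a - 1) y t).
Proof.
move=> t0; have tn0 : t != 0 by rewrite gt_eqF.
rewrite bessel_kernelV// /bessel_kernel addrK.
have d1 := is_derive_div y t0.
have d2 := is_derive1_powR a t0.
have d3 : is_derive t (1 : R) (fun t => - t - y / t) (- 1 + y / t ^+ 2).
  by rewrite -[_ / _ ^+ 2]opprK; apply: is_deriveB.
have d4 : is_derive t (1 : R) (expR \o (fun t => - t - y / t))
  ((- 1 + y / t ^+ 2) * expR (- t - y / t)).
  by apply: is_derive_eq; rewrite mulrC.
have d5 := is_deriveM d2 d4.
apply: (@is_derive_eq _ _ _ _ _ _ _ _ d5).
rewrite /GRing.scale/=.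
rewrite (powR_mulB1 a t0).
by field.
Qed.

End bessel_kernel.

(** * Integrability, recurrence, symmetry and log-convexity of the Mellin integral *)

Section bessel_mellin.
Context {R : realType}.
Notation mu := (@lebesgue_measure R).
Implicit Types (a b c t y s u v : R).

(** The inequality [s / b <= expR (s / b)] raised to the power [b]. It serves the domination and
    decay estimates below. *)
Lemma powR_expRN_le b s : 0 < b -> 0 < s -> s `^ b * expR (- s) <= b `^ b.
Proof.
move=> b0 s0.
have h : s <= b * expR (s / b).
  rewrite -ler_pdivrMl// mulrC (le_trans _ (expR_ge1Dx _))//.
  by rewrite lerDr.
have := ge0_ler_powR (ltW b0) (ltW s0 : s \in Num.nneg)
  (ltW (lt_le_trans s0 h) : _ \in Num.nneg) h.
rewrite /= powRM ?expR_ge0 ?(ltW b0)// -expRM divfK ?gt_eqF// => {}h.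
by rewrite expRN ler_pdivrMr ?expR_gt0.
Qed.

Lemma bessel_kernel_continuous a y :
  {in `]0, +oo[, continuous (bessel_kernel a y)}.
Proof.
move=> t; rewrite in_itv/= andbT => t0; rewrite -(subrK 1 a).
exact: is_derive_continuous (is_derive_bessel_kernel _ _ t0).
Qed.

Lemma bessel_kernel_measurable a y :
  measurable_fun `](0 : R), +oo[ (EFin \o bessel_kernel a y).
Proof.
apply/measurable_EFinP; apply: halfline_continuous_measurable.
exact: bessel_kernel_continuous.
Qed.

Lemma bessel_kernel_dominated a y (g : R -> R) c :
  mu.-integrable `](0 : R), +oo[ (EFin \o g) ->
  (forall t, 0 < t -> bessel_kernel a y t <= c * g t) ->
  mu.-integrable `](0 : R), +oo[ (EFin \o bessel_kernel a y).
Proof.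
move=> ig h.
have : mu.-integrable `](0 : R), +oo[ (fun t => c%:E * (g t)%:E)%E.
  exact: integrableZl.
apply: le_integrable => //; first exact: bessel_kernel_measurable.
move=> t /=; rewrite in_itv/= andbT => t0.
rewrite lee_fin ger0_norm ?bessel_kernel_ge0//.
by rewrite (le_trans (h t t0))// ler_norm.
Qed.

(* The primitive (t / (1 + t))^a / a of the dominating function is bounded. *)
Lemma powR_div_onep_integrable a : 0 < a ->
  mu.-integrable `](0 : R), +oo[
    (EFin \o (fun t => (t / (1 + t)) `^ (a - 1) / (1 + t) ^+ 2)).
Proof.
move=> a0.
have d1 t : 0 < t -> is_derive t (1 : R) (fun t => t / (1 + t)) ((1 + t) ^- 2).
  move=> t0; have tn0 : 1 + t != 0 by rewrite gt_eqF// addr_gt0.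
  have dp : is_derive t (1 : R) (fun t => 1 + t) 1.
    have dp := is_deriveD (is_derive_cst (1 : R) t (1 : R)) (is_derive_id t (1 : R)).
    by apply: (@is_derive_eq _ _ _ _ _ _ _ _ dp); rewrite add0r.
  have dV := is_deriveV tn0 dp.
  apply: (@is_derive_eq _ _ _ _ _ _ _ _ (is_deriveM (is_derive_id t 1) dV)).
  by rewrite /GRing.scale/=; field.
have p0 t : 0 < t -> 0 < t / (1 + t) by move=> t0; rewrite divr_gt0// addr_gt0.
have dpow b t : 0 < t -> is_derive t (1 : R) (fun t => (t / (1 + t)) `^ b)
    (b * (t / (1 + t)) `^ (b - 1) / (1 + t) ^+ 2).
  move=> t0; have dq := is_derive1_powR b (p0 _ t0); have dt := d1 _ t0.
  exact: (@is_derive1_comp _ (@powR R ^~ b) (fun t => t / (1 + t)) _ _ _ dq dt).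
apply: (@halfline_bounded_primitive_integrable _ _
  (fun t => (t / (1 + t)) `^ a / a) a^-1).
- move=> t; rewrite in_itv/= andbT => t0.
  apply: (@continuousM R R (fun t => (t / (1 + t)) `^ (a - 1))
    (fun t => (1 + t) ^- 2)).
    exact: is_derive_continuous (dpow _ _ t0).
  apply: continuousV; first by rewrite expf_neq0// gt_eqF// addr_gt0.
  apply: (@continuous_comp _ _ _ (fun t => 1 + t) (fun t => t ^+ 2)).
    by apply: continuousD => //; exact: cst_continuous.
  exact: exprn_continuous.
- move=> t t0; rewrite divr_ge0 ?powR_ge0// sqr_ge0//.
- move=> t t0; have dt := dpow a _ t0.
  apply: (@is_derive_eq _ _ _ _ _ _ _ _ (is_deriveM dt (is_derive_cst a^-1 t 1))).
  rewrite /GRing.scale/= mulr0 add0r.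
  by rewrite !mulrA mulVf ?mul1r// gt_eqF.
- move=> t t0; rewrite ger0_norm ?divr_ge0 ?powR_ge0 ?(ltW a0)//.
  rewrite ler_pdivrMr// mulVf ?gt_eqF//.
  rewrite -[leRHS](powRr0 (t / (1 + t))).
  apply: ger_powR; rewrite ?(ltW a0)// p0//=.
  by rewrite ler_pdivrMr ?addr_gt0// mul1r lerDr.
Qed.

(** After splitting off (t / (1 + t))^(a - 1), the rest is compared with (1 + t)^(-2) through the
    bound on (1 + t)^(a + 1) exp(-(1 + t)). The factor [expR 1] pays for replacing [t] by [1 + t] in
    the exponential. *)
Lemma bessel_kernel_integrable_pos a y : 0 < a -> 0 <= y ->
  mu.-integrable `](0 : R), +oo[ (EFin \o bessel_kernel a y).
Proof.
move=> a0 y0.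
apply: (bessel_kernel_dominated (c := (a + 1) `^ (a + 1) * expR 1)
  (powR_div_onep_integrable a0)) => t t0.
have t10 : 0 < 1 + t by rewrite addr_gt0.
have h := powR_expRN_le (addr_gt0 a0 ltr01) t10.
rewrite /bessel_kernel.
have -> : t `^ (a - 1) = (t / (1 + t)) `^ (a - 1) * (1 + t) `^ (a - 1).
  by rewrite -powRM ?divr_ge0 ?ltW// divfK ?gt_eqF.
rewrite mulrCA -!mulrA ler_wpM2l ?powR_ge0//.
apply: (@le_trans _ _ ((1 + t) `^ (a - 1) * expR (- t))).
  by rewrite ler_wpM2l ?powR_ge0// ler_expR gerBl divr_ge0 ?(ltW t0).
rewrite [leRHS]mulrA ler_pdivlMr ?exprn_gt0//.
rewrite -ler_pdivrMr ?expR_gt0// -expRN (le_trans _ h)//.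
have -> : (1 + t) `^ (a + 1) = (1 + t) ^+ 2 * (1 + t) `^ (a - 1).
  by rewrite expr2 -mulrA -(powR_mulB1 a)// (powR_mulB1 (a + 1))// addrK.
rewrite opprD addrC expRD.
by rewrite le_eqVlt; apply/orP; left; apply/eqP; ring.
Qed.

(** The factor exp(-y/t) is at most a multiple of t^N, which raises the order [a] to the positive
    [a + N] and reduces to the kernel at [y = 0]. *)
Lemma bessel_kernel_integrable a y : 0 < y ->
  mu.-integrable `](0 : R), +oo[ (EFin \o bessel_kernel a y).
Proof.
move=> y0; pose N : R := `|a| + 1.
have N0 : 0 < N by rewrite ltr_wpDl.
have aN : 0 < a + N by have := ler_norm (- a); rewrite normrN /N; lra.
apply: (bessel_kernel_dominated (c := N `^ N / y `^ N)
  (bessel_kernel_integrable_pos aN (lexx 0))) => t t0.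
have h := powR_expRN_le N0 (divr_gt0 y0 t0).
have pt b : 0 < t `^ b by rewrite powR_gt0.
have {}h : expR (- (y / t)) <= N `^ N / y `^ N * t `^ N.
  move: h; rewrite powRM ?invr_ge0 ?(ltW y0) ?(ltW t0)//.
  rewrite -powR_inv1 ?(ltW t0)// -powRrM mulN1r powRN.
  rewrite -ler_pdivlMl ?divr_gt0 ?powR_gt0// => /le_trans; apply.
  rewrite invfM invrK le_eqVlt; apply/orP; left; apply/eqP.
  by set yV := (y `^ N)^-1; ring.
rewrite /bessel_kernel mul0r subr0 expRD.
rewrite [a + N - 1](_ : _ = a - 1 + N); last by ring.
rewrite (@powRD _ t (a - 1)) ?(gt_eqF t0) ?implybT//.
have p0 : 0 <= t `^ (a - 1) * expR (- t) by rewrite mulr_ge0 ?powR_ge0 ?expR_ge0.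
rewrite [leLHS]mulrA; apply: (le_trans (ler_wpM2l p0 h)).
by rewrite le_eqVlt; apply/orP; left; apply/eqP; ring.
Qed.

Let integrable_oy (f : R -> R) := mu.-integrable `](0 : R), +oo[ (EFin \o f).

Let integrable_oyZ c f : integrable_oy f -> integrable_oy (fun t => c * f t).
Proof.
move=> intf.
have : mu.-integrable `](0 : R), +oo[ (fun t => c%:E * (f t)%:E)%E.
  exact: integrableZl.
by [].
Qed.

Let integrable_oyD f g : integrable_oy f -> integrable_oy g ->
  integrable_oy (fun t => f t + g t).
Proof.
move=> intf intg.
have : mu.-integrable `](0 : R), +oo[ (fun t => (f t)%:E + (g t)%:E)%E.
  exact: integrableD.
by [].
Qed.

Let RintegralZ_oy c f : integrable_oy f ->
  \int[mu]_(t in `]0, +oo[) (c * f t) = c * \int[mu]_(t in `]0, +oo[) f t.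
Proof. by move=> intf; rewrite RintegralZl. Qed.

Let RintegralD_oy f g : integrable_oy f -> integrable_oy g ->
  \int[mu]_(t in `]0, +oo[) (f t + g t) =
  \int[mu]_(t in `]0, +oo[) f t + \int[mu]_(t in `]0, +oo[) g t.
Proof. by move=> intf intg; rewrite RintegralD. Qed.

(** Common source of the recurrence for [0 < y] and of the functional equation of Gamma at [y = 0].
    The factor [y] stays inside the last integral because at [y = 0] the kernel of order [a - 1] is
    not integrable for [a <= 1], whereas the product is zero. *)
Let bessel_mellin_rec_of a y : 0 <= y ->
  integrable_oy (bessel_kernel a y) -> integrable_oy (bessel_kernel (a + 1) y) ->
  integrable_oy (fun t => y * bessel_kernel (a - 1) y t) ->
  bessel_kernel (a + 1) y n.+1%:R^-1 @[n --> \oo] --> 0 ->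
  bessel_mellin (a + 1) y = a * bessel_mellin a y
    + \int[mu]_(t in `]0, +oo[) (y * bessel_kernel (a - 1) y t).
Proof.
move=> y0 i0 i1 iV lim0.
have ck b : {in `]0, +oo[, continuous (bessel_kernel b y)}.
  exact: bessel_kernel_continuous.
have cZ c b : {in `]0, +oo[, continuous (fun t => c * bessel_kernel b y t)}.
  move=> t t0; apply: (@continuousM R R (cst c) (bessel_kernel b y)).
    exact: cst_continuous.
  exact: ck.
have iZ c := integrable_oyZ c i0.
(* Splitting a = (|a| + a) - |a| makes both integrands nonnegative. *)
have -> : bessel_mellin (a + 1) y =
  \int[mu]_(t in `]0, +oo[) (bessel_kernel (a + 1) y t + `|a| * bessel_kernel a y t)
  - `|a| * bessel_mellin a y.
  by rewrite RintegralD_oy// RintegralZ_oy// addrK.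
suff <- : \int[mu]_(t in `]0, +oo[)
    (y * bessel_kernel (a - 1) y t + (`|a| + a) * bessel_kernel a y t) =
  \int[mu]_(t in `]0, +oo[) (bessel_kernel (a + 1) y t + `|a| * bessel_kernel a y t).
  rewrite RintegralD_oy// (RintegralZ_oy _ i0) -/(bessel_mellin a y).
  by ring.
apply: (@halfline_integral_primitive_eq0 _ _ _ (bessel_kernel (a + 1) y)).
- move=> t t0; apply: (@continuousD R R R (fun t => y * bessel_kernel (a - 1) y t)
    (fun t => (`|a| + a) * bessel_kernel a y t)); exact: cZ.
- move=> t t0; apply: (@continuousD R R R (bessel_kernel (a + 1) y)
    (fun t => `|a| * bessel_kernel a y t)); [exact: ck|exact: cZ].
- move=> t t0; apply: addr_ge0; rewrite mulr_ge0 ?bessel_kernel_ge0//.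
  by have := ler_norm (- a); rewrite normrN; lra.
- by move=> t t0; rewrite addr_ge0 ?(mulr_ge0 (normr_ge0 _)) ?bessel_kernel_ge0.
- exact: integrable_oyD.
- exact: integrable_oyD.
- move=> t t0; have d := is_derive_bessel_kernel a y t0.
  by apply: (@is_derive_eq _ _ _ _ _ _ _ _ d); ring.
(* Since [a + 1 <= N], the boundary term at [n.+1%:R], multiplied by [n.+1%:R], is at most N^N. *)
- pose N : R := `|a| + 2.
  apply: (@squeeze_cvgr _ _ _ _ (cst 0) (fun n => N `^ N * n.+1%:R^-1)).
  + near=> n.
    have n0 : 0 < n.+1%:R :> R by rewrite ltr0n.
    rewrite /cst bessel_kernel_ge0/= ler_pdivlMr//.
    rewrite mulrC -bessel_kernelM// /bessel_kernel addrK.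
    have N0 : 0 < N by rewrite /N ltr_wpDl.
    apply: le_trans (powR_expRN_le N0 n0); apply: ler_pM.
    * exact: powR_ge0.
    * exact: expR_ge0.
    * by apply: ler_powR; [rewrite ler1n|rewrite /N; have := ler_norm a; lra].
    * by rewrite ler_expR gerBl divr_ge0// ltW.
  + exact: cvg_cst.
  + rewrite -(mulr0 (N `^ N)); apply: cvgM; first exact: cvg_cst.
    exact: cvg_harmonic.
- exact: lim0.
Unshelve. all: by end_near. Qed.

Lemma bessel_mellin_rec a y : 0 < y ->
  bessel_mellin (a + 1) y = a * bessel_mellin a y + y * bessel_mellin (a - 1) y.
Proof.
move=> y0.
rewrite bessel_mellin_rec_of ?(ltW y0)//; first last.
(* At t = 1/(n+1) the factor exp(-y/t) is exp(-y(n+1)); it absorbs (n+1)^(1-a) because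
   [1 - a <= N]. *)
- pose N : R := `|a| + 1.
  have N0 : 0 < N by rewrite /N ltr_wpDl.
  apply: (@squeeze_cvgr _ _ _ _ (cst 0)
    (fun n => N `^ N / y `^ N * n.+1%:R^-1)).
  + near=> n.
    have n0 : 0 < n.+1%:R :> R by rewrite ltr0n.
    rewrite /cst bessel_kernel_ge0/= ler_pdivlMr//.
    rewrite /bessel_kernel addrK invrK -powR_inv1 ?(ltW n0)// -powRrM mulN1r.
    have h := powR_expRN_le N0 (mulr_gt0 y0 n0).
    rewrite ler_pdivlMr ?powR_gt0//; apply: le_trans h.
    rewrite powRM ?(ltW y0) ?(ltW n0)//.
    apply: (@le_trans _ _ (n.+1%:R `^ (- a) * expR (- (y * n.+1%:R)) * n.+1%:R * y `^ N)).
      rewrite !ler_pM2r ?powR_gt0// ler_pM2l ?powR_gt0// ler_expR.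
      by rewrite gerDr oppr_le0 powR_ge0.
    rewrite -[leRHS]mulrA [leRHS]mulrC ler_pM2r ?powR_gt0//.
    rewrite mulrAC ler_pM2r ?expR_gt0// -[X in _ * X <= _](powRr1 (ltW n0)).
    rewrite -powRD ?(gt_eqF n0) ?implybT//.
    by apply: ler_powR; [rewrite ler1n|rewrite /N; have := ler_norm (- a); rewrite normrN; lra].
  + exact: cvg_cst.
  + rewrite -(mulr0 (N `^ N / y `^ N)); apply: cvgM; first exact: cvg_cst.
    exact: cvg_harmonic.
- by apply: integrable_oyZ; exact: bessel_kernel_integrable.
- exact: bessel_kernel_integrable.
- exact: bessel_kernel_integrable.
by rewrite RintegralZ_oy//; exact: bessel_kernel_integrable.
Unshelve. all: by end_near. Qed.

Lemma euler_gammaS a : 0 < a -> euler_gamma (a + 1) = a * euler_gamma a.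
Proof.
move=> a0; rewrite !euler_gammaE bessel_mellin_rec_of//.
- by under eq_Rintegral do rewrite mul0r; rewrite Rintegral_cst// mul0r addr0.
- exact: bessel_kernel_integrable_pos.
- by apply: bessel_kernel_integrable_pos => //; rewrite addr_gt0.
- under [X in integrable_oy X]eq_fun do rewrite mul0r.
  exact: integrable0.
- apply: (@squeeze_cvgr _ _ _ _ (cst 0) (fun n => n.+1%:R^-1 `^ a)).
  + near=> n; rewrite /cst bessel_kernel_ge0/=.
    by rewrite /bessel_kernel addrK mul0r subr0 ler_piMr ?powR_ge0.
  + exact: cvg_cst.
  + have := powR_cvg0 a0 => /cvg_at_rightP; apply; split.
      by move=> n; rewrite invr_gt0 ltr0n.
    exact: cvg_harmonic.
Unshelve. all: by end_near. Qed.

Lemma bessel_mellin_sym a y : 0 < y ->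
  bessel_mellin (- a) y = y `^ (- a) * bessel_mellin a y.
Proof.
move=> y0; rewrite /bessel_mellin (halfline_integral_inversion y0); last 2 first.
- exact: bessel_kernel_continuous.
- by move=> t _; exact: bessel_kernel_ge0.
rewrite -RintegralZ_oy; last exact: bessel_kernel_integrable.
apply: eq_Rintegral => t /set_mem/=; rewrite in_itv/= andbT => t0.
have tn0 : t != 0 by rewrite gt_eqF.
have yn0 : y != 0 by rewrite gt_eqF.
have yt : y / (y / t) = t by field; apply/andP.
rewrite /bessel_kernel yt [- (y / t) - t]addrC.
rewrite mulrAC mulrA; congr (_ * _).
rewrite powRM ?(ltW y0) ?invr_ge0 ?(ltW t0)// -powR_inv1 ?(ltW t0)// -powRrM.
rewrite (powR_mulB1 (- a) y0) [-1 * _](_ : _ = a + 1); last by ring.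
rewrite (powR_mulB1 (a + 1) t0) addrK (powR_mulB1 a t0).
by field.
Qed.

(** A nonnegative integrand of integral 0 vanishes almost everywhere, while the kernel is positive
    on a set of infinite measure. The disjunction secures integrability: a divergent integral would
    get the value [fine +oo], that is 0. *)
Lemma bessel_mellin_gt0 a y : 0 <= y -> 0 < a \/ 0 < y -> 0 < bessel_mellin a y.
Proof.
move=> y0 h.
have ik : integrable_oy (bessel_kernel a y).
  by case: h => h; [exact: bessel_kernel_integrable_pos|exact: bessel_kernel_integrable].
rewrite lt_neqAle Rintegral_ge0 ?andbT; last first.
  by move=> t _; exact: bessel_kernel_ge0.
apply/eqP => /esym M0.
have : (\int[mu]_(t in `]0%R, +oo[) `|(bessel_kernel a y t)%:E|)%E = 0%E.
  under eq_integral do rewrite gee0_abs ?lee_fin ?bessel_kernel_ge0//.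
  by move/eqP: M0; rewrite /bessel_mellin/Rintegral fine_eq0 ?integrable_fin_num// => /eqP.
move/ae_eq_integral_abs => /(_ (measurable_itv _) (bessel_kernel_measurable _ _)).
move=> [N [mN N0 DN]].
have : (mu `]0%R, +oo[ <= mu N)%E.
  apply: le_measure; rewrite ?inE// => t /=; rewrite in_itv/= andbT => t0.
  apply: DN => /= /(_ (gt0_itvoy t0))/eqP; apply/negP.
  by rewrite eqe gt_eqF// bessel_kernel_gt0.
by rewrite N0 lebesgue_measure_itv/= ltry addye.
Qed.

(* Cauchy-Schwarz: integrate t^(a-2) (p - q t)^2 e^(-t-y/t) >= 0 with
   p = M a and q = M (a - 1). *)
Lemma bessel_mellin_turan a y : 0 < y ->
  bessel_mellin a y ^+ 2 <= bessel_mellin (a - 1) y * bessel_mellin (a + 1) y.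
Proof.
move=> y0.
have M0 b : 0 < bessel_mellin b y by apply: bessel_mellin_gt0; [exact: ltW|right].
have ik b : integrable_oy (bessel_kernel b y) by exact: bessel_kernel_integrable.
pose p := bessel_mellin a y; pose q := bessel_mellin (a - 1) y.
have : 0 <= \int[mu]_(t in `]0, +oo[)
    (p ^+ 2 * bessel_kernel (a - 1) y t + (q ^+ 2 * bessel_kernel (a + 1) y t
     + (- (2 * p * q)) * bessel_kernel a y t)).
  apply: Rintegral_ge0 => t /=; rewrite in_itv/= andbT => t0.
  rewrite bessel_kernelM// bessel_kernelV//.
  have -> : p ^+ 2 * (bessel_kernel a y t / t) + (q ^+ 2 * (t * bessel_kernel a y t)
    + - (2 * p * q) * bessel_kernel a y t) =
    (p - q * t) ^+ 2 * bessel_kernel a y t / t by field; rewrite gt_eqF.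
  by rewrite divr_ge0 ?(ltW t0)// mulr_ge0 ?sqr_ge0 ?bessel_kernel_ge0.
rewrite !RintegralD_oy//; do ?[exact: integrable_oyZ]; last first.
  by apply: integrable_oyD; exact: integrable_oyZ.
rewrite !RintegralZ_oy// -/(bessel_mellin a y) -/(bessel_mellin (a - 1) y).
rewrite -/(bessel_mellin (a + 1) y) -/p -/q.
have q0 : 0 < q := M0 _.
set r := bessel_mellin (a + 1) y => h.
have : 0 <= q * (q * r - p ^+ 2) by move: h; lra.
by rewrite pmulr_rge0// subr_ge0.
Qed.

End bessel_mellin.

(** * Dependence of the Mellin integral on its argument and on its order *)

Section bessel_mellin_regularity.
Context {R : realType}.
Notation mu := (@lebesgue_measure R).
Implicit Types (a b c t y s u v : R).

Lemma is_derive_bessel_kernel2 a y t : 0 < t ->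
  is_derive y (1 : R) (fun y => bessel_kernel a y t) (- bessel_kernel (a - 1) y t).
Proof.
move=> t0; rewrite bessel_kernelV//.
have d1 : is_derive y (1 : R) (fun y => - t - y / t) (- t^-1).
  have d := is_deriveB (is_derive_cst (- t) y (1 : R))
    (is_deriveM (is_derive_id y (1 : R)) (is_derive_cst t^-1 y (1 : R))).
  apply: (@is_derive_eq _ _ _ _ _ _ _ _ d).
  by rewrite /GRing.scale/= mulr0 mulr1 !add0r.
have d2 := @is_derive1_comp _ expR (fun y => - t - y / t) y _ _ (is_derive_expR _) d1.
have d3 := is_deriveM (is_derive_cst (t `^ (a - 1)) y (1 : R)) d2.
apply: (@is_derive_eq _ _ _ _ _ _ _ _ d3).
by rewrite /GRing.scale/= mulr0 addr0 /bessel_kernel; ring.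
Qed.

Lemma bessel_kernel_le a y1 y2 t : 0 < t -> y1 <= y2 ->
  bessel_kernel a y2 t <= bessel_kernel a y1 t.
Proof.
move=> t0 y12; rewrite ler_wpM2l ?powR_ge0// ler_expR lerD2l lerN2.
by rewrite ler_pM2r ?invr_gt0.
Qed.

(** Differentiation under the integral on [](y / 2), (2 * y)[]: the kernel decreases in [y], so the
    kernel of order [a - 1] at [y / 2] dominates the derivative. *)
Lemma is_derive_bessel_mellin a y : 0 < y ->
  is_derive y (1 : R) (bessel_mellin a) (- bessel_mellin (a - 1) y).
Proof.
move=> y0.
have Ia : `](y / 2), (2 * y)[%classic y.
  by rewrite /= in_itv/=; apply/andP; split; lra.
have y20 : 0 < y / 2 by rewrite divr_gt0.
have pos x : `](y / 2), (2 * y)[%classic x -> 0 < x.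
  by rewrite /= in_itv/= => /andP[+ _]; exact: lt_trans.
have intf x : `](y / 2), (2 * y)[%classic x ->
    mu.-integrable `](0 : R), +oo[ (EFin \o bessel_kernel a x).
  by move=> /pos; exact: bessel_kernel_integrable.
have derf x t : `](y / 2), (2 * y)[%classic x -> `](0 : R), +oo[%classic t ->
    derivable (bessel_kernel a ^~ t) x 1.
  rewrite /= => _; rewrite in_itv/= andbT => t0.
  by have := is_derive_bessel_kernel2 a x t0.
have d1E x t : 0 < t ->
    partial1of2 (bessel_kernel a) x t = - bessel_kernel (a - 1) x t.
  move=> t0; rewrite partial1of2E.
  by have d := is_derive_bessel_kernel2 a x t0; rewrite derive_val.
have G_ub x t : `](y / 2), (2 * y)[%classic x -> `](0 : R), +oo[%classic t ->
    `|partial1of2 (bessel_kernel a) x t| <= bessel_kernel (a - 1) (y / 2) t.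
  rewrite /= !in_itv/= andbT => /andP[x1 _] t0.
  rewrite d1E// normrN ger0_norm ?bessel_kernel_ge0//.
  by rewrite bessel_kernel_le// ltW.
have iG := bessel_kernel_integrable (a - 1) y20.
have G0 := bessel_kernel_ge0 (a - 1) (y / 2).
have dM : derivable (bessel_mellin a) y 1.
  exact: (derivable_under_integral _ Ia intf derf G0 iG G_ub).
apply: (DeriveDef dM).
have dE : derive1 (bessel_mellin a) y =
    \int[mu]_(t in `]0, +oo[) partial1of2 (bessel_kernel a) y t.
  exact: (differentiation_under_integral _ Ia intf derf G0 iG G_ub).
rewrite -derive1E dE.
have <- : \int[mu]_(t in `]0, +oo[) (-1 * bessel_kernel (a - 1) y t) =
    - bessel_mellin (a - 1) y.
  by rewrite RintegralZl ?mulN1r//; exact: bessel_kernel_integrable.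
apply: eq_Rintegral => t /set_mem/=; rewrite in_itv/= andbT => t0.
by rewrite d1E// mulN1r.
Qed.

(** Needed for the limit that defines [besselK] at the integers. For orders between [u] and [a + 1]
    the kernel is below the one of order [u] when [t <= 1] and below the one of order [a + 1] when
    [1 < t], so the sum of both dominates. *)
Lemma bessel_mellin_continuous a y : 0 <= y -> 0 < a \/ 0 < y ->
  {for a, continuous (fun a => bessel_mellin a y)}.
Proof.
move=> y0 h.
have [u [ua iu]] : exists u, u < a /\ forall b, u <= b ->
    mu.-integrable `](0 : R), +oo[ (EFin \o bessel_kernel b y).
  case: h => [a0|y1].
    exists (a / 2); split; first lra.
    by move=> b ub; apply: bessel_kernel_integrable_pos => //; lra.
  by exists (a - 1); split; [lra|move=> b _; exact: bessel_kernel_integrable].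
have Iu x : `]u, (a + 1)[%classic x -> u <= x.
  by rewrite /= in_itv/= => /andP[+ _]; exact: ltW.
apply: (@continuity_under_integral R _ _ mu (fun a t => bessel_kernel a y t)
  `](0 : R), +oo[ _ u (a + 1) _ _
  (fun t => bessel_kernel u y t + bessel_kernel (a + 1) y t)) => //.
- by move=> x /Iu; exact: iu.
- apply: aeW => t /=; rewrite in_itv/= andbT => t0 x _.
  apply: (@continuousM R R (fun a => t `^ (a - 1)) (cst (expR (- t - y / t)))); last first.
    exact: cst_continuous.
  have -> : (fun a => t `^ (a - 1)) = (fun a => expR ((a - 1) * ln t)).
    by apply/funext => b; rewrite /powR gt_eqF.
  apply: continuous_comp; last exact: continuous_expR.
  apply: continuousM; last exact: cst_continuous.
  by apply: continuousB => //; exact: cst_continuous.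
- have : mu.-integrable `](0 : R), +oo[
    (fun t => (bessel_kernel u y t)%:E + (bessel_kernel (a + 1) y t)%:E)%E.
    by apply: integrableD => //; apply: iu; lra.
  by [].
- move=> x; rewrite /= in_itv/= => /andP[/ltW ux /ltW xv].
  apply: aeW => t /=; rewrite in_itv/= andbT => t0.
  rewrite ger0_norm ?bessel_kernel_ge0// -mulrDl ler_pM2r ?expR_gt0//.
  have [t1|/ltW t1] := leP t 1.
    rewrite ler_wpDr ?powR_ge0//; apply: ger_powR; first by rewrite t0.
    by rewrite lerD2r.
  rewrite ler_wpDl ?powR_ge0//; apply: ler_powR => //.
  by rewrite lerD2r.
- by rewrite inE/= in_itv/=; apply/andP; split; lra.
Qed.

(** Squeeze from 1 - y/t <= exp(-y/t) <= 1. The correction y/t lowers the order to [a - 1], whence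
    [1 < a]. *)
Lemma bessel_mellin_cvg0 a : 1 < a ->
  bessel_mellin a y @[y --> 0^'+] --> bessel_mellin a 0.
Proof.
move=> a1.
have a0 : 0 < a by exact: lt_trans a1.
have i0 := bessel_kernel_integrable_pos a0 (lexx 0).
have i1 : mu.-integrable `](0 : R), +oo[ (EFin \o bessel_kernel (a - 1) 0).
  by apply: bessel_kernel_integrable_pos => //; rewrite subr_gt0.
apply: (@squeeze_cvgr _ _ _ _
  (fun y => bessel_mellin a 0 - y * bessel_mellin (a - 1) 0)
  (cst (bessel_mellin a 0))).
- near=> y.
  have y0 : 0 < y by near: y; exact: nbhs_right_gt.
  have iy := bessel_kernel_integrable a y0.
  apply/andP; split; last first.
    apply: le_Rintegral => // t /=; rewrite in_itv/= andbT => t0.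
    by apply: bessel_kernel_le => //; exact: ltW.
  have iz : mu.-integrable `](0 : R), +oo[ (EFin \o (fun t => y * bessel_kernel (a - 1) 0 t)).
    have : mu.-integrable `](0 : R), +oo[ (fun t => y%:E * (bessel_kernel (a - 1) 0 t)%:E)%E.
      exact: integrableZl.
    by [].
  have <- : \int[mu]_(t in `]0, +oo[)
      (bessel_kernel a 0 t - y * bessel_kernel (a - 1) 0 t) =
      bessel_mellin a 0 - y * bessel_mellin (a - 1) 0.
    by rewrite RintegralB// RintegralZl.
  apply: le_Rintegral => //.
    have : mu.-integrable `](0 : R), +oo[ (fun t => (bessel_kernel a 0 t)%:E -
      (y * bessel_kernel (a - 1) 0 t)%:E)%E by exact: integrableB.
    by [].
  move=> t /=; rewrite in_itv/= andbT => t0.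
  rewrite bessel_kernelV// /bessel_kernel mul0r subr0 expRD.
  have := expR_ge1Dx (- (y / t)); set e := expR (- (y / t)) => h.
  have p0 : 0 < t `^ (a - 1) * expR (- t) by rewrite mulr_gt0 ?powR_gt0 ?expR_gt0.
  rewrite -subr_ge0.
  have -> : t `^ (a - 1) * (expR (- t) * e) - (t `^ (a - 1) * expR (- t)
      - y * (t `^ (a - 1) * expR (- t) / t)) =
      t `^ (a - 1) * expR (- t) * (e - (1 - y / t)).
    by field; rewrite gt_eqF.
  by rewrite mulr_ge0 ?(ltW p0)// subr_ge0.
- suff : bessel_mellin a 0 - y * bessel_mellin (a - 1) 0 @[y --> 0^'+] -->
    bessel_mellin a 0 - 0 * bessel_mellin (a - 1) 0 by rewrite mul0r subr0.
  apply: cvgB; first exact: cvg_cst.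
  apply: cvgM; last exact: cvg_cst.
  exact: cvg_at_right_filter.
- exact: cvg_cst.
Unshelve. all: by end_near. Qed.

End bessel_mellin_regularity.

(** * The reciprocal Gamma function on the real line *)

Section rgamma.
Context {R : realType}.
Implicit Types (z nu : R).

Lemma euler_gamma_gt0 z : 0 < z -> 0 < euler_gamma z.
Proof. by move=> z0; rewrite euler_gammaE bessel_mellin_gt0//; left. Qed.

Lemma rgammaE z : 0 < z -> rgamma z = (euler_gamma z)^-1.
Proof. by move=> z0; rewrite /rgamma z0. Qed.

(** For [z + 1 <= 0] the product defining [rgamma z] has just one factor more than that of
    [rgamma (z + 1)], namely [z]; for [z <= 0 < z + 1] it is [z] alone. *)
Lemma rgammaS z : rgamma z = z * rgamma (z + 1).
Proof.
rewrite /rgamma; have [z0|z0] := ltP 0 z.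
  by rewrite addr_gt0// euler_gammaS// invfM mulVKf// gt_eqF.
have [z1|z1] := ltP 0 (z + 1).
  have -> : Num.truncn (- z) = 0%N by apply: truncn_def; apply/andP; split; lra.
  by rewrite big_ord1 addr0.
have -> : Num.truncn (- z) = (Num.truncn (- (z + 1))).+1.
  have z1' : 0 <= - (z + 1) by rewrite oppr_ge0.
  apply: truncn_def; have /andP[] := truncn_itv z1'.
  by rewrite -!natr1 => h1 h2; apply/andP; split; lra.
set n := (Num.truncn _).+1; rewrite big_ord_recl addr0 -mulrA; congr (_ * _).
congr (_ / euler_gamma _); last by rewrite -(natr1 n); ring.
by apply: eq_bigr => i _; rewrite lift0 -natr1; ring.
Qed.

Lemma rgamma_gt0 z : 0 < z -> 0 < rgamma z.
Proof. by move=> z0; rewrite rgammaE// invr_gt0 euler_gamma_gt0. Qed.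

Lemma rgamma_neq0 z : z \isn't a Num.int -> rgamma z != 0.
Proof.
move=> zN; rewrite /rgamma; case: ltP => z0.
  by rewrite invr_eq0 gt_eqF// euler_gamma_gt0.
rewrite mulf_neq0//.
  apply/prodf_neq0 => i _; apply: contra zN.
  rewrite addr_eq0 => /eqP ->.
  by rewrite rpredN rpred_nat.
rewrite invr_eq0 gt_eqF// euler_gamma_gt0//.
have z0' : 0 <= - z by rewrite oppr_ge0.
by have /andP[_] := truncn_itv z0'; lra.
Qed.

(** Once [1 <= nu + k%:R + 1], the functional equation makes the absolute values nonincreasing in
    [k]; the earlier ones are bounded by their sum. *)
Lemma rgamma_shift_bounded nu :
  exists B, forall k : nat, `|rgamma (nu + k%:R + 1)| <= B.
Proof.
pose r k := `|rgamma (nu + k%:R + 1)|.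
pose K := (Num.truncn (- nu)).+1.
have rK k : (K <= k)%N -> r k.+1 <= r k.
  move=> Kk; rewrite /r (rgammaS (nu + k%:R + 1)).
  have h1 : 1 <= nu + k%:R + 1.
    rewrite lerDr; have := truncnS_gt (- nu); have : K%:R <= k%:R :> R by rewrite ler_nat.
    by rewrite /K; lra.
  rewrite normrM [X in _ <= X * _]ger0_norm; last by rewrite (le_trans _ h1).
  by rewrite -natr1 addrA ler_peMl.
exists (\sum_(i < K.+1) r i) => k; rewrite -/(r k).
have r0 i : 0 <= r i by exact: normr_ge0.
have le i : (i < K.+1)%N -> r i <= \sum_(i < K.+1) r i.
  move=> iK; rewrite (bigD1 (Ordinal iK))//= lerDl.
  by apply: sumr_ge0.
elim: k => [|k IH]; first exact: le.
have [kK|Kk] := ltnP k K; first exact: le.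
exact: le_trans (rK _ Kk) IH.
Qed.

End rgamma.

(** * The power series of I: convergence, derivative, recurrence, Turan bound *)

Section bessel_series.
Local Opaque rgamma.
Context {R : realType}.
Implicit Types (nu y x : R).

Definition bessel_coef nu (k : nat) : R := rgamma (nu + k%:R + 1) / k`!%:R.

Definition bessel_series nu y : R := limn (pseries (bessel_coef nu) y).

(** Termwise comparison with [B] times the exponential series at |y|. *)
Lemma is_cvg_bessel_series nu y : cvgn (pseries (bessel_coef nu) y).
Proof.
have [B HB] := rgamma_shift_bounded nu.
have B0 : 0 <= B by apply: le_trans (HB 0%N).
apply: normed_cvg; apply: (@series_le_cvg _ _ (B *: exp_coeff `|y|)).
- by move=> n /=; exact: normr_ge0.
- move=> n; rewrite /GRing.scale/= mulr_ge0// exp_coeff_ge0//.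
- move=> n; rewrite /GRing.scale/= /exp_coeff/= /bessel_coef.
  rewrite !normrM normrX normfV (ger0_norm (ler0n _ _)).
  rewrite [leLHS]mulrAC [leRHS]mulrA.
  by rewrite ler_wpM2r ?invr_ge0// ler_wpM2r ?exprn_ge0.
- exact/is_cvg_seriesZ/is_cvg_series_exp_coeff.
Qed.
Arguments is_cvg_bessel_series : clear implicits.

Lemma cvg_bessel_series nu y :
  pseries (bessel_coef nu) y @ \oo --> bessel_series nu y.
Proof. exact: is_cvg_bessel_series. Qed.
Arguments cvg_bessel_series : clear implicits.

Lemma pseries_diffs_bessel_coef nu :
  pseries_diffs (bessel_coef nu) = bessel_coef (nu + 1).
Proof.
apply/funext => k; rewrite /pseries_diffs /bessel_coef factS natrM invfM.
have -> : nu + k.+1%:R + 1 = nu + 1 + k%:R + 1 by rewrite -natr1; ring.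
have k0 : k.+1%:R != 0 :> R by rewrite pnatr_eq0.
by rewrite mulrCA (mulVKf k0).
Qed.

Lemma is_derive_bessel_series nu y :
  is_derive y (1 : R) (bessel_series nu) (bessel_series (nu + 1) y).
Proof.
rewrite /bessel_series -pseries_diffs_bessel_coef.
apply: (@pseries_snd_diffs _ _ (`|y| + 1)).
- exact: is_cvg_bessel_series.
- by rewrite pseries_diffs_bessel_coef; exact: is_cvg_bessel_series.
- by rewrite !pseries_diffs_bessel_coef; exact: is_cvg_bessel_series.
- by rewrite [ltRHS]ger0_norm ?addr_ge0// ltrDl.
Qed.

Lemma bessel_coefS nu k :
  bessel_coef nu k = (nu + k%:R + 1) * bessel_coef (nu + 1) k.
Proof.
rewrite /bessel_coef (rgammaS (nu + k%:R + 1)) mulrA.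
by have -> : nu + 1 + k%:R + 1 = nu + k%:R + 1 + 1 by ring.
Qed.

(** In the factor of [bessel_coefS], the part [nu + 1] gives the first term and the part [k] gives
    [y] times the derivative of [bessel_series (nu + 1)]. *)
Lemma bessel_series_rec nu y :
  bessel_series nu y =
  (nu + 1) * bessel_series (nu + 1) y + y * bessel_series (nu + 1 + 1) y.
Proof.
have h0 := cvg_bessel_series (nu + 1) y.
have h1 : series (fun i => i%:R * bessel_coef (nu + 1) i * y ^+ i.-1) @ \oo -->
    bessel_series (nu + 1 + 1) y.
  have := @pseries_diffs_equiv _ (bessel_coef (nu + 1)) y.
  by rewrite pseries_diffs_bessel_coef; apply; exact: is_cvg_bessel_series.
apply: cvg_lim => //.
have -> : pseries (bessel_coef nu) y = (fun n =>
    (nu + 1) * pseries (bessel_coef (nu + 1)) y n +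
    y * series (fun i => i%:R * bessel_coef (nu + 1) i * y ^+ i.-1) n).
  apply/funext => n; rewrite /pseries /series/= !mulr_sumr -big_split/=.
  apply: eq_bigr => -[|i] _; rewrite bessel_coefS; first by rewrite /= !expr0; ring.
  by rewrite /= exprS; ring.
apply: cvgD.
  by apply: cvgM; [exact: cvg_cst|exact: h0].
by apply: cvgM; [exact: cvg_cst|exact: h1].
Qed.

Lemma bessel_series0 nu : bessel_series nu 0 = rgamma (nu + 1).
Proof.
(* The shift discards the empty partial sum, which is 0 and not the constant term. *)
apply: cvg_lim => //; rewrite -cvg_shiftS.
rewrite (_ : (fun n => _) = cst (rgamma (nu + 1))); first exact: cvg_cst.
apply/funext => n; rewrite /pseries /series/= big_nat_recl//= big1 ?addr0.
  by rewrite /bessel_coef fact0 divr1 expr0 mulr1 addr0.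
by move=> i _; rewrite exprS mul0r mulr0.
Qed.

Lemma bessel_coef_gt0 nu k : -1 < nu -> 0 < bessel_coef nu k.
Proof.
move=> nu1; rewrite divr_gt0 ?ltr0n ?fact_gt0// rgamma_gt0//.
by have := ler0n R k; lra.
Qed.

Lemma bessel_series_gt0 nu y : -1 < nu -> 0 <= y -> 0 < bessel_series nu y.
Proof.
move=> nu1 y0.
apply: (lt_le_trans (bessel_coef_gt0 0 nu1)).
apply: limr_ge; first exact: is_cvg_bessel_series.
exists 1%N => // -[//|n] _; rewrite /pseries /series/= big_nat_recl//= expr0 mulr1.
rewrite lerDl; apply: sumr_ge0 => i _.
by rewrite mulr_ge0 ?exprn_ge0// ltW// bessel_coef_gt0.
Qed.

Lemma besselIE nu x : 0 < x ->
  besselI nu x = (x / 2) `^ nu * bessel_series nu ((x / 2) ^+ 2).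
Proof.
move=> x0; have x20 : 0 < x / 2 by rewrite divr_gt0.
rewrite /besselI /bessel_series /pseries.
have := lim_seriesZ ((x / 2) `^ nu)
  (is_cvg_bessel_series nu ((x / 2) ^+ 2)).
rewrite /GRing.scale/= => <-; congr (limn (series _)).
apply/funext => k; rewrite /GRing.scale/= powRD ?(gt_eqF x20) ?implybT//.
rewrite powR_mulrn ?(ltW x20)// -exprM mul2n /bessel_coef.
by rewrite -mulrA mulrAC mulrC [X in _ * X]mulrC.
Qed.

Local Opaque bessel_series bessel_coef.

(* Cauchy-Schwarz for the weights w_k = coef nu k * y^k, for which
   coef (nu - 1) k = (nu + k) coef nu k and
   coef (nu + 1) k = coef nu k / (nu + k + 1). *)
Lemma bessel_series_CauchySchwarz nu y : 0 < nu -> 0 <= y ->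
  bessel_series nu y ^+ 2 <=
  bessel_series (nu + 1) y * (bessel_series (nu - 1) y + bessel_series nu y).
Proof.
move=> nu0 y0.
have nu1 : -1 < nu + 1 by lra.
have num1 : -1 < nu - 1 by lra.
have E0 := bessel_series_gt0 (lt_trans (ltrN10 R) nu0) y0.
have Em0 := bessel_series_gt0 num1 y0.
pose q := bessel_series (nu - 1) y + bessel_series nu y.
pose p := bessel_series nu y.
have q0 : 0 < q := addr_gt0 Em0 E0.
have : p ^+ 2 * q - 2 * p * q * p + q ^+ 2 * bessel_series (nu + 1) y >= 0.
  pose S nu := pseries (bessel_coef nu) y.
  have h : p ^+ 2 * (S (nu - 1) n + S nu n) - 2 * p * q * S nu n
      + q ^+ 2 * S (nu + 1) n @[n --> \oo] -->
      p ^+ 2 * q - 2 * p * q * p + q ^+ 2 * bessel_series (nu + 1) y.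
    have c nu' : S nu' @ \oo --> bessel_series nu' y by exact: cvg_bessel_series.
    apply: cvgD; last by apply: cvgM; [exact: cvg_cst|exact: c].
    apply: cvgB; last by apply: cvgM; [exact: cvg_cst|exact: c].
    by apply: cvgM; [exact: cvg_cst|apply: cvgD; exact: c].
  rewrite -(cvg_lim _ h)//; apply: limr_ge; first exact: (cvgP _ h).
  apply: nearW => n; rewrite /S /pseries /series/= -big_split/= !mulr_sumr -sumrB -big_split/=.
  apply: sumr_ge0 => k _.
  have b0 := bessel_coef_gt0 k nu1.
  have bk := bessel_coefS nu k; have bk' := bessel_coefS (nu - 1) k.
  rewrite subrK in bk'.
  rewrite bk' bk.
  set m := nu + k%:R + 1; set b := bessel_coef (nu + 1) k.
  have -> : nu - 1 + k%:R + 1 = m - 1 by rewrite /m; ring.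
  have -> : p ^+ 2 * ((m - 1) * (m * b) * y ^+ k + m * b * y ^+ k) -
    2 * p * q * (m * b * y ^+ k) + q ^+ 2 * (b * y ^+ k) =
    (p * m - q) ^+ 2 * (b * y ^+ k) by ring.
  by rewrite mulr_ge0 ?sqr_ge0// mulr_ge0 ?exprn_ge0// ltW.
have -> : p ^+ 2 * q - 2 * p * q * p + q ^+ 2 * bessel_series (nu + 1) y =
  q * (bessel_series (nu + 1) y * q - p ^+ 2) by ring.
by rewrite pmulr_rge0// subr_ge0.
Qed.

Lemma bessel_series_turan nu y : 0 < nu -> 0 < y ->
  nu * bessel_series nu y ^+ 2 <=
  (nu + 1) * (bessel_series (nu - 1) y * bessel_series (nu + 1) y).
Proof.
move=> nu0 y0.
have nu1 : -1 < nu + 1 by lra.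
have num1 : -1 < nu - 1 by lra.
have cs := bessel_series_CauchySchwarz nu0 (ltW y0).
have rec := bessel_series_rec (nu - 1) y; rewrite subrK in rec.
have gt0 nu' : -1 < nu' -> 0 < bessel_series nu' y.
  by move=> h; apply: bessel_series_gt0 => //; exact: ltW.
have Em0 := gt0 _ num1; have E0 := gt0 _ (lt_trans (ltrN10 R) nu0).
have Ep0 := gt0 _ nu1.
move: cs rec Em0 E0 Ep0.
set m := bessel_series (nu - 1) y; set e := bessel_series nu y.
set q := bessel_series (nu + 1) y => cs rec m0 e0 q0.
have yq : 0 < y * q by rewrite mulr_gt0.
have me : nu * e <= m by rewrite rec lerDl ltW.
have h1 := ler_wpM2l (ltW m0) cs.
have h2 := ler_wpM2l (ltW q0) me.
(* [cs] times [nu] gives [nu * e ^+ 2 <= nu * q * m + q * (nu * e)], and [h2] bounds the last term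
   by [q * m]. *)
nra.
Qed.

End bessel_series.

(** * Wronskian identities and the connection formula *)

Section bessel_connection.
Context {R : realType}.
Implicit Types (nu mu y x : R).
Local Opaque euler_gamma rgamma bessel_series bessel_mellin.

Lemma bessel_series_continuous nu y : {for y, continuous (bessel_series nu)}.
Proof. exact: is_derive_continuous (is_derive_bessel_series nu y). Qed.

(** With x = 2 sqrt(y) this is the classical x (I_nu K_(nu+1) + I_(nu+1) K_nu). *)
Let U nu y := bessel_series nu y * bessel_mellin (nu + 1) y
  + y * bessel_series (nu + 1) y * bessel_mellin nu y.

Let is_derive_U nu y : 0 < y -> is_derive y (1 : R) (U nu) 0.
Proof.
move=> y0.
have dE := is_derive_bessel_series nu y.
have dE1 := is_derive_bessel_series (nu + 1) y.
have dM1 := is_derive_bessel_mellin (nu + 1) y0; rewrite addrK in dM1.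
have dM := is_derive_bessel_mellin nu y0.
have d := is_deriveD (is_deriveM dE dM1)
  (is_deriveM (is_deriveM (is_derive_id y (1 : R)) dE1) dM).
apply: (@is_derive_eq _ _ _ _ _ _ _ _ d).
rewrite /GRing.scale/= !fctE (bessel_series_rec nu) (bessel_mellin_rec nu y0).
move: (bessel_series (nu + 1) y) (bessel_series (nu + 1 + 1) y) => e1 e2.
move: (bessel_mellin nu y) (bessel_mellin (nu - 1) y) => m0 m1.
by ring.
Qed.

Let U_const nu y1 y2 : 0 < y1 -> 0 < y2 -> U nu y1 = U nu y2.
Proof.
(* Composing with [expR] gives a function on the whole line, where a zero derivative forces
   constancy. *)
move=> y10 y20; rewrite -(lnK y10) -(lnK y20).
apply: (@is_derive_0_is_cst _ (U nu \o expR)) => s.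
have dU := is_derive_U nu (expR_gt0 s).
have d := @is_derive1_comp _ (U nu) expR s _ _ dU (is_derive_expR s).
by apply: (@is_derive_eq _ _ _ _ _ _ _ _ d); rewrite mul0r.
Qed.

(** [bessel_mellin_cvg0] does not reach the order [nu] when [nu <= 1], so the recurrence replaces y
    M nu by M (nu + 2) - (nu + 1) M (nu + 1), which tends to 0 by the functional equation of
    Gamma. *)
Let cvg_U nu : 0 < nu -> U nu y @[y --> 0^'+] --> (1 : R).
Proof.
move=> nu0.
have cE mu : bessel_series mu y @[y --> 0^'+] --> rgamma (mu + 1).
  rewrite -bessel_series0; apply: cvg_at_right_filter.
  exact: bessel_series_continuous.
have cM mu : 1 < mu -> bessel_mellin mu y @[y --> 0^'+] --> euler_gamma mu.
  by move=> mu1; rewrite euler_gammaE; exact: bessel_mellin_cvg0.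
have nu1 : 1 < nu + 1 by rewrite ltrDr.
have nu2 : 1 < nu + 1 + 1 by rewrite ltrDr (lt_trans ltr01).
have -> : 1 = rgamma (nu + 1) * euler_gamma (nu + 1) + rgamma (nu + 1 + 1) *
    (euler_gamma (nu + 1 + 1) - (nu + 1) * euler_gamma (nu + 1)).
  have g0 : 0 < nu + 1 by exact: lt_trans nu1.
  have rg : rgamma (nu + 1) * euler_gamma (nu + 1) = 1.
    by rewrite (rgammaE g0); apply: mulVf; rewrite (gt_eqF (euler_gamma_gt0 g0)).
  have aux (a b c d e : R) : a * b = 1 -> c = e * b -> 1 = a * b + d * (c - e * b).
    by move=> -> ->; rewrite subrr mulr0 addr0.
  exact: (aux _ _ _ _ _ rg (euler_gammaS g0)).
have h : bessel_series nu y * bessel_mellin (nu + 1) y + bessel_series (nu + 1) y *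
    (bessel_mellin (nu + 1 + 1) y - (nu + 1) * bessel_mellin (nu + 1) y) @[y --> 0^'+] -->
    rgamma (nu + 1) * euler_gamma (nu + 1) + rgamma (nu + 1 + 1) *
    (euler_gamma (nu + 1 + 1) - (nu + 1) * euler_gamma (nu + 1)).
  apply: cvgD; first by apply: cvgM; [exact: cE|exact: cM].
  apply: cvgM; first exact: cE.
  apply: cvgB; first exact: cM.
  by apply: cvgM; [exact: cvg_cst|exact: cM].
apply: cvg_trans h; apply: near_eq_cvg; near=> y.
have y0 : 0 < y by near: y; exact: nbhs_right_gt.
rewrite /U (bessel_mellin_rec (nu + 1) y0) addrK.
move: (bessel_series nu y) (bessel_series (nu + 1) y) => e0 e1.
by move: (bessel_mellin (nu + 1) y) (bessel_mellin nu y) => m0 m1; ring.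
Unshelve. all: by end_near. Qed.

Let US nu y : 0 < y -> U nu y = U (nu + 1) y.
Proof.
move=> y0; rewrite /U (bessel_series_rec nu).
rewrite (bessel_mellin_rec (nu + 1) y0) addrK.
move: (bessel_series (nu + 1) y) (bessel_series (nu + 1 + 1) y) => e0 e1.
by move: (bessel_mellin (nu + 1) y) (bessel_mellin nu y) => m0 m1; ring.
Qed.

(** Constancy in [y] and the limit at 0 settle positive orders; invariance under [nu -> nu + 1]
    carries the value to all real orders. *)
Lemma bessel_wronskian_mellin nu y : 0 < y ->
  bessel_series nu y * bessel_mellin (nu + 1) y
  + y * bessel_series (nu + 1) y * bessel_mellin nu y = 1.
Proof.
move=> y0; rewrite -/(U nu y).
have h mu : 0 < mu -> U mu y = 1.
  move=> mu0; apply: (cvg_unique _ _ (cvg_U mu0)) => //.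
  have e : {near 0^'+, (cst (U mu y) : R -> R) =1 U mu}.
    by near=> s; apply: U_const => //; near: s; exact: nbhs_right_gt.
  by move/near_eq_cvg/cvg_trans: e; apply; exact: cvg_cst.
have shift n : U nu y = U (nu + n%:R) y.
  elim: n => [|n IH]; first by rewrite addr0.
  by rewrite -natr1 addrA; exact: (etrans IH (US _ y0)).
rewrite (shift (Num.truncn (- nu)).+1); apply: h.
by have := truncnS_gt (- nu); lra.
Unshelve. all: by end_near. Qed.

(** Both series are differentiable on the whole line, so the constant is read off at [y = 0]. *)
Lemma bessel_wronskian_series nu y :
  bessel_series (- nu - 1) y * bessel_series nu y
  - y * bessel_series (- nu) y * bessel_series (nu + 1) y =
  rgamma (- nu) * rgamma (nu + 1).
Proof.
pose V y := bessel_series (- nu - 1) y * bessel_series nu y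
  - y * bessel_series (- nu) y * bessel_series (nu + 1) y.
have -> : rgamma (- nu) * rgamma (nu + 1) = V 0.
  by rewrite /V !bessel_series0 subrK !mul0r subr0.
apply: (@is_derive_0_is_cst _ V) => {}y.
have dE := is_derive_bessel_series nu y.
have dE1 := is_derive_bessel_series (nu + 1) y.
have dN := is_derive_bessel_series (- nu) y.
have dN1 := is_derive_bessel_series (- nu - 1) y; rewrite subrK in dN1.
have d := is_deriveB (is_deriveM dN1 dE)
  (is_deriveM (is_deriveM (is_derive_id y (1 : R)) dN) dE1).
apply: (@is_derive_eq _ _ _ _ _ _ _ _ d).
rewrite /GRing.scale/= !fctE (bessel_series_rec nu) (bessel_series_rec (- nu - 1)) subrK.
move: (bessel_series (nu + 1) y) (bessel_series (nu + 1 + 1) y) => e1 e2.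
by move: (bessel_series (- nu) y) (bessel_series (- nu + 1) y) => f1 f2; ring.
Qed.

Lemma bessel_connection nu y : 0 < y ->
  bessel_series (- nu) y - y `^ nu * bessel_series nu y =
  rgamma (1 - nu) * rgamma nu * bessel_mellin nu y.
Proof.
move=> y0.
have hU := bessel_wronskian_mellin nu y0.
have hV := bessel_wronskian_series nu y.
have hN := bessel_wronskian_mellin (- nu) y0.
have rE := bessel_series_rec (- nu - 1) y; rewrite subrK in rE.
have rM := bessel_mellin_rec nu y0.
have sM := bessel_mellin_sym nu y0.
have sM1 := bessel_mellin_sym (nu - 1) y0; rewrite opprB addrC in sM1.
have p0 : 0 < y `^ nu by rewrite powR_gt0.
have pN : y `^ (- nu) = (y `^ nu)^-1 by rewrite powRN.
have pN1 : y `^ (- nu + 1) = y / y `^ nu.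
  by rewrite powRD ?(gt_eqF y0) ?implybT// powRr1 ?(ltW y0)// powRN mulrC.
rewrite pN1 in sM1; rewrite pN in sM; rewrite sM sM1 in hN.
have g1 := rgammaS nu; have g2 := rgammaS (- nu); rewrite addrC in g2.
rewrite g1; move: hV; rewrite g2.
move: hU hN rE rM p0.
move: (rgamma (1 - nu)) (rgamma (nu + 1)) (y `^ nu) => c1 c2 p.
move: (bessel_series nu y) (bessel_series (nu + 1) y) => e0 e1.
move: (bessel_series (- nu) y) (bessel_series (- nu + 1) y) => f0 f1.
move: (bessel_series (- nu - 1) y) => f2.
move: (bessel_mellin nu y) (bessel_mellin (nu - 1) y) => m0 m1.
move: (bessel_mellin (nu + 1) y) => m2.
move=> hU hN rE rM p0 hV.
have pn0 : p != 0 by rewrite gt_eqF.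
(* This is the Wronskian identity at order [- nu], brought back to order [nu] by the symmetry of M
   and the two recurrences. *)
have hp : f0 * m2 + f2 * m0 = p.
  rewrite rE rM -[RHS]mulr1 -hN.
  by field.
(* Inserting [hU] as a factor 1 and [hp] for [p] makes [m2] cancel, leaving [- m0] times the
   Wronskian of the two series. *)
have -> : f0 - p * e0 = f0 * (e0 * m2 + y * e1 * m0) - p * e0.
  by rewrite hU mulr1.
rewrite -hp.
have -> : f0 * (e0 * m2 + y * e1 * m0) - (f0 * m2 + f2 * m0) * e0 =
  - m0 * (f2 * e0 - y * f0 * e1) by ring.
by rewrite hV; ring.
Qed.

End bessel_connection.

(** * K as a multiple of the Mellin integral, integral orders included *)

Section besselK.
Context {R : realType}.
Implicit Types (nu mu y x a z : R).
Local Opaque euler_gamma rgamma bessel_series bessel_mellin.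

Lemma periodic1_int (T : Type) (f : R -> T) : (forall a, f (a + 1) = f a) ->
  forall (k : int) a, f (a + k%:~R) = f a.
Proof.
move=> h.
have hn (n : nat) a : f (a + n%:R) = f a.
  by elim: n => [|n IH]; [rewrite addr0|rewrite -natr1 addrA h].
move=> [n|n] a; first exact: hn.
by rewrite NegzE mulrNz -[in RHS](subrK n.+1%:R a) hn.
Qed.

Lemma sin_mulpiS a : sin ((a + 1) * pi) = - sin (a * pi).
Proof. by rewrite mulrDl mul1r sinD sinpi cospi mulr0 addr0 mulrN1. Qed.

(** The squared sine has period 1 in [nu], and subtracting the floor brings [nu] into the open unit
    interval, where the sine is positive. *)
Lemma sin_mulpi_neq0 nu : nu \isn't a Num.int -> sin (nu * pi) != 0.
Proof.
move=> nuN.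
have per a : sin ((a + 1) * pi) ^+ 2 = sin (a * pi) ^+ 2.
  by rewrite sin_mulpiS sqrrN.
have := @periodic1_int _ (fun a => sin (a * pi) ^+ 2) per (- Num.floor nu) nu.
rewrite mulrNz => e; rewrite -sqrf_eq0 -e sqrf_eq0 gt_eqF//.
have lo := ge_floor nu; have hi := floorD1_gt nu.
have ne : (Num.floor nu)%:~R != nu.
  by apply: contra nuN => /eqP <-; exact: intr_int.
have lt1 : (Num.floor nu)%:~R < nu by rewrite lt_neqAle ne.
apply: sin_gt0_pi; apply/andP; split.
  by rewrite mulr_gt0 ?pi_gt0// subr_gt0.
rewrite gtr_pMl ?pi_gt0//.
by move: hi; rewrite intrD; lra.
Qed.

(** Quotient of the two sides of the reflection formula for Gamma. *)
Definition besselK_ratio nu : R := pi * (rgamma (1 - nu) * rgamma nu) / sin (nu * pi).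

(** The functional equation moves the factor [nu] from one [rgamma] to the other with a minus sign,
    which cancels the sign change of the sine. *)
Lemma besselK_ratioS nu : besselK_ratio (nu + 1) = besselK_ratio nu.
Proof.
rewrite /besselK_ratio sin_mulpiS.
have -> : 1 - (nu + 1) = - nu by ring.
have g1 := rgammaS nu; have g2 := rgammaS (- nu).
rewrite [- nu + 1]addrC in g2; rewrite g1 g2 invrN.
move: (rgamma (1 - nu)) (rgamma (nu + 1)) => c1 c2.
move: (sin (nu * pi))^-1 => s.
by move: (pi : R) => p; ring.
Qed.

Lemma besselK_quotientE nu x : 0 < x -> besselK_quotient nu x =
  besselK_ratio nu * (2^-1 * ((x / 2) `^ (- nu) * bessel_mellin nu ((x / 2) ^+ 2))).
Proof.
move=> x0; rewrite /besselK_quotient !besselIE//.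
have z0 : 0 < x / 2 by rewrite divr_gt0.
move: (x / 2) z0 => z z0.
have y0 : 0 < z ^+ 2 by rewrite exprn_gt0.
have h := bessel_connection nu y0.
have zy : (z ^+ 2) `^ nu = z `^ nu * z `^ nu by rewrite expr2 powRM ?(ltW z0).
have zN : z `^ nu = z `^ (- nu) * (z ^+ 2) `^ nu.
  by rewrite zy powRN mulrA mulVf ?mul1r// gt_eqF// powR_gt0.
have e : z `^ (- nu) * bessel_series (- nu) (z ^+ 2)
    - z `^ nu * bessel_series nu (z ^+ 2) = z `^ (- nu) *
    (rgamma (1 - nu) * rgamma nu * bessel_mellin nu (z ^+ 2)).
  by rewrite -h mulrBr mulrA -zN.
rewrite e /besselK_ratio.
move: (rgamma (1 - nu)) (rgamma nu) (bessel_mellin nu (z ^+ 2)) => c1 c2 m.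
move: (sin (nu * pi))^-1 (z `^ (- nu)) => s p.
by move: (pi : R) => q; ring.
Qed.

(** In the limit at an integer N, the arguments of [rgamma] become 1 - (mu - N) and 1 + (mu - N),
    which both tend to 1. *)
Lemma rgamma_continuous1 : {for (1 : R), continuous (@rgamma R)}.
Proof.
have c1 : {for (1 : R), continuous (fun z : R => (bessel_mellin z 0)^-1)}.
  apply: continuousV; last by apply: bessel_mellin_continuous => //; left.
  by rewrite gt_eqF// bessel_mellin_gt0//; left.
have e z : 0 < z -> rgamma z = (bessel_mellin z 0)^-1.
  by move=> z0; rewrite rgammaE// euler_gammaE.
rewrite /prop_for /continuous_at (e 1 ltr01).
apply: cvg_trans c1; apply: near_eq_cvg; near=> z.
by apply/esym; apply: e; near: z; exact: lt_nbhsr.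
Unshelve. all: by end_near. Qed.

(** Periodicity translates the order by the integer; then rgamma d = d rgamma (d + 1) with d = mu -
    n cancels the simple zero of sin(d pi), and the quotient extends continuously to [n]. *)
Lemma besselK_int (n : int) x : 0 < x -> besselK n%:~R x =
  rgamma 1 ^+ 2 * (2^-1 * ((x / 2) `^ (- n%:~R) * bessel_mellin n%:~R ((x / 2) ^+ 2))).
Proof.
move=> x0; rewrite /besselK intr_int.
pose N : R := n%:~R; rewrite -/N.
have z0 : 0 < x / 2 by rewrite divr_gt0.
have y0 : 0 < (x / 2) ^+ 2 by rewrite exprn_gt0.
(* Caratheodory's form of the derivative factors the zero [z - N] out of the sine, with a cofactor
   continuous at [N]. *)
have [g [gE cg gN]] : exists g : R -> R,
    [/\ forall z, sin ((z - N) * pi) - sin ((N - N) * pi) = g z * (z - N),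
        {for N, continuous g} & g N = pi].
  apply/(is_derive1_caratheodory (fun z => sin ((z - N) * pi))).
  have d1 : is_derive N (1 : R) (fun z => (z - N) * pi) pi.
    have d := is_deriveM (is_deriveB (is_derive_id N (1 : R)) (is_derive_cst N N (1 : R)))
      (is_derive_cst (pi : R) N (1 : R)).
    apply: (@is_derive_eq _ _ _ _ _ _ _ _ d).
    by rewrite /GRing.scale/= mulr0 add0r subr0 mulr1.
  have d2 := @is_derive1_comp _ (@sin R) (fun z => (z - N) * pi) N _ _ (is_derive_sin _) d1.
  apply: (@is_derive_eq _ _ _ _ _ _ _ _ d2).
  by rewrite subrr mul0r cos0 mul1r.
have {}gE z : sin ((z - N) * pi) = g z * (z - N).
  by rewrite -gE subrr mul0r sin0 subr0.
pose H mu := rgamma (1 - (mu - N)) * rgamma (1 + (mu - N)) * (pi / g mu) *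
  (2^-1 * ((x / 2) `^ (- mu) * bessel_mellin mu ((x / 2) ^+ 2))).
have ratioE mu : mu != N -> besselK_ratio mu =
    rgamma (1 - (mu - N)) * rgamma (1 + (mu - N)) * (pi / g mu).
  move=> muN.
  have := periodic1_int besselK_ratioS (- n) mu; rewrite mulrNz -/N => <-.
  rewrite /besselK_ratio gE (rgammaS (mu - N)) [1 + (mu - N)]addrC invfM.
  have m0 : mu - N != 0 by rewrite subr_eq0.
  move: (rgamma (1 - (mu - N))) (rgamma (mu - N + 1)) => c1 c2.
  move: (g mu)^-1 => s; move: (pi : R) (mu - N) m0 => q d d0.
  by field.
have HE mu : mu != N -> besselK_quotient mu x = H mu.
  by move=> muN; rewrite besselK_quotientE// ratioE.
have cH : {for N, continuous H}.
  have c1 : {for N, continuous (fun mu => rgamma (1 - (mu - N)))}.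
    apply: (@continuous_comp _ _ _ (fun mu => 1 - (mu - N))).
      apply: continuousB; first exact: cst_continuous.
      by apply: continuousB => //; exact: cst_continuous.
    by rewrite subrr subr0; exact: rgamma_continuous1.
  have c2 : {for N, continuous (fun mu => rgamma (1 + (mu - N)))}.
    apply: (@continuous_comp _ _ _ (fun mu => 1 + (mu - N))).
      apply: continuousD; first exact: cst_continuous.
      by apply: continuousB => //; exact: cst_continuous.
    by rewrite subrr addr0; exact: rgamma_continuous1.
  have c3 : {for N, continuous (fun mu => pi / g mu)}.
    apply: (@continuousM _ _ (cst pi)); first exact: cst_continuous.
    by apply: continuousV => //; rewrite gN gt_eqF// pi_gt0.
  have c4 : {for N, continuous (fun mu => (x / 2) `^ (- mu))}.
    have -> : (fun mu => (x / 2) `^ (- mu)) = (fun mu => expR (- mu * ln (x / 2))).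
      by apply/funext => mu; rewrite /powR gt_eqF.
    apply: (@continuous_comp _ _ _ (fun mu => - mu * ln (x / 2))).
      apply: continuousM; last exact: cst_continuous.
      exact: continuousN.
    exact: continuous_expR.
  have c5 : {for N, continuous (fun mu => bessel_mellin mu ((x / 2) ^+ 2))}.
    by apply: bessel_mellin_continuous; [exact: ltW|right].
  have cc : {for N, continuous (cst (2^-1 : R) : R -> R)} by exact: cst_continuous.
  exact: (continuousM (continuousM (continuousM c1 c2) c3)
    (continuousM cc (continuousM c4 c5))).
have HN : H N = rgamma 1 ^+ 2 *
    (2^-1 * ((x / 2) `^ (- N) * bessel_mellin N ((x / 2) ^+ 2))).
  by rewrite /H subrr subr0 addr0 gN divff ?gt_eqF ?pi_gt0// mulr1 expr2.
rewrite -HN; apply: cvg_lim => //.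
have /continuous_withinNx := cH; apply: cvg_trans; apply: near_eq_cvg.
near=> mu; apply/esym; apply: HE; near: mu; exact: nbhs_dnbhs_neq.
Unshelve. all: by end_near. Qed.

(** At integral orders [besselK_ratio] divides by zero and is replaced by its limit there. *)
Definition besselK_factor nu : R :=
  if nu \is a Num.int then rgamma 1 ^+ 2 else besselK_ratio nu.

Lemma besselKE nu x : 0 < x -> besselK nu x = besselK_factor nu *
  (2^-1 * ((x / 2) `^ (- nu) * bessel_mellin nu ((x / 2) ^+ 2))).
Proof.
move=> x0; rewrite /besselK_factor; case: ifPn => [/intrP[n ->]|nuN].
  exact: besselK_int.
by rewrite /besselK (negbTE nuN) besselK_quotientE.
Qed.

Lemma besselK_factorS nu : besselK_factor (nu + 1) = besselK_factor nu.
Proof.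
rewrite /besselK_factor besselK_ratioS.
have [nuI|nuN] := boolP (nu \is a Num.int); first by rewrite rpredD ?rpred1.
rewrite ifN//; apply: contra nuN => h.
by rewrite -(addrK 1 nu) rpredB ?rpred1.
Qed.

(** Nonvanishing keeps the final inequality strict after scaling by the square of the factor. *)
Lemma besselK_factor_neq0 nu : besselK_factor nu != 0.
Proof.
rewrite /besselK_factor; case: ifPn => nuN.
  by rewrite sqrf_eq0 gt_eqF// rgamma_gt0.
have nuN' : 1 - nu \isn't a Num.int.
  by apply: contra nuN => h; rewrite -[nu](subKr 1) rpredB ?rpred1.
apply: mulf_neq0; last by rewrite invr_eq0 sin_mulpi_neq0.
by apply: mulf_neq0; [rewrite gt_eqF ?pi_gt0|rewrite mulf_neq0 ?rgamma_neq0].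
Qed.

Lemma besselPE nu x : 0 < x -> besselP nu x = besselK_factor nu / 2 *
  (bessel_series nu ((x / 2) ^+ 2) * bessel_mellin nu ((x / 2) ^+ 2)).
Proof.
move=> x0; rewrite /besselP besselIE// besselKE//.
have z0 : (x / 2) `^ nu != 0 by rewrite gt_eqF// powR_gt0// divr_gt0.
rewrite powRN; move: (bessel_series _ _) (bessel_mellin _ _) (_ `^ _) z0 => e m p p0.
by field.
Qed.

End besselK.

(** * Combination of the two Turan bounds *)

Theorem mainTheorem7 (R : realType) (nu x : R) (hnu : 1 / 2 < nu) (hx : 0 < x) :
  besselP nu x ^+ 2 - besselP (nu - 1) x * besselP (nu + 1) x
    < 1 / (nu + 1 / 2) * besselP nu x ^+ 2.
Proof.
have y0 : 0 < (x / 2) ^+ 2 by rewrite exprn_gt0// divr_gt0.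
have nu0 : 0 < nu by lra.
have nu1 : -1 < nu by lra.
have c0 := besselK_factor_neq0 nu.
rewrite !besselPE// besselK_factorS.
have -> : besselK_factor (nu - 1) = besselK_factor nu.
  by rewrite -(besselK_factorS (nu - 1)) subrK.
have tE := bessel_series_turan nu0 y0.
have tM := bessel_mellin_turan nu y0.
have E0 := bessel_series_gt0 nu1 (ltW y0).
have M0 := bessel_mellin_gt0 (ltW y0) (or_intror (0 < nu) y0).
(* The three orders share this factor by periodicity, and every term is quadratic in it, so its
   square divides out. *)
have {c0} : 0 < (besselK_factor nu / 2) ^+ 2.
  by rewrite exprn_even_gt0//= mulf_neq0// invr_eq0 pnatr_eq0.
move: tE tM E0 M0.
move: (besselK_factor nu / 2) (bessel_series nu _) (bessel_mellin nu _) => c e m.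
move: (bessel_series (nu - 1) _) (bessel_series (nu + 1) _) => e1 e2.
move: (bessel_mellin (nu - 1) _) (bessel_mellin (nu + 1) _) => m1 m2.
move=> tE tM e0 m0 c0.
have X0 : 0 < e ^+ 2 * m ^+ 2 by rewrite mulr_gt0 ?exprn_gt0.
have tP : nu * (e ^+ 2 * m ^+ 2) <= (nu + 1) * (e1 * e2 * (m1 * m2)).
  by rewrite mulrA [leRHS]mulrA ler_pM// ?mulr_ge0 ?sqr_ge0// ltW.
have -> : 1 / (nu + 1 / 2) * (c * (e * m)) ^+ 2 =
    c ^+ 2 * (e ^+ 2 * m ^+ 2 / (nu + 1 / 2)) by field; lra.
have -> : (c * (e * m)) ^+ 2 - c * (e1 * m1) * (c * (e2 * m2)) =
    c ^+ 2 * (e ^+ 2 * m ^+ 2 - e1 * e2 * (m1 * m2)) by ring.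
rewrite ltr_pM2l//.
move: (e ^+ 2 * m ^+ 2) (e1 * e2 * (m1 * m2)) X0 tP => X Q X0 tP.
rewrite ltr_pdivlMr; last by lra.
have nu10 : 0 < nu + 1 by lra.
rewrite -(ltr_pM2l nu10).
(* With [h] the left side of the goal is at most [(nu + 1 / 2) * X]; strictness comes from
   [nu + 1 / 2 < nu + 1] and [0 < X]. *)
have h : (nu + 1 / 2) * (nu * X) <= (nu + 1 / 2) * ((nu + 1) * Q).
  by rewrite ler_pM2l//; lra.
lra.
Qed.
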